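(* There is a universal constant $C>0$ such that the following holds. Let $G$ be an $n$-vertex graph with degeneracy $\kappa$. Let $k \in [1,n]$ (a ''guess'' for $\kappa$) and let $s \ge Cn\log n$ (a sparsity parameter). Put \[ \ell = \left\lceil \frac{2nk}{s} \right\rceil, \qquad \lambda = 3\sqrt{\kappa \ell \log n}, \] and let $\psi\colon V(G)\to[\ell]$ be a uniformly random coloring, i.e., each vertex independently receives a color chosen uniformly from $[\ell]=\{1,\dots,\ell\}$. For $i\in[\ell]$ let $G_i$ be the subgraph of $G$ induced by $\psi^{-1}(i)$. Then: (i) if $k\le 2\kappa$, then with probability at least $1-1/\mathrm{poly}(n)$, for every $i$, the degeneracy $\kappa(G_i)\le (\kappa+\lambda)/\ell$; (ii) with probability at least $1-1/\mathrm{poly}(n)$, for every $i$, $|V(G_i)|\le 2n/\ell$; (iii) if $\kappa\le k\le 2\kappa$, then with probability at least $1-1/\mathrm{poly}(n)$, the number of monochromatic edges $|E(G_1)\cup\cdots\cup E(G_\ell)|$ is at most $s$.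
   Context: Graphs are simple, undirected. $\log$ denotes $\log_2$. A graph is $k$-degenerate if every induced subgraph has a vertex of degree at most $k$; the degeneracy $\kappa(G)$ is the smallest such $k$. *)

(* Defs.v *)
From HB Require Import structures.
From mathcomp Require Import all_boot all_order all_algebra.
From mathcomp Require Import reals exp.

Set Implicit Arguments.
Unset Strict Implicit.
Unset Printing Implicit Defensive.

Import Order.TTheory GRing.Theory Num.Theory.

Local Open Scope ring_scope.

Record sgraph (V : finType) := SGraph {
  adj :> rel V;
  adj_sym : symmetric adj;
  adj_irr : irreflexive adj
}.

(* A vertex set S stands for the induced subgraph G[S]; G itself is G[setT].  *)
(* The induced subgraphs of G[S] are the G[U] with U a subset of S.           *)
Section Graphs.
Variables (V : finType) (G : sgraph V).
Implicit Types (S U : {set V}) (v : V).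

Definition degree S v : nat := #|[set w in S | G v w]|.

Definition edges S : {set {set V}} :=
  [set [set x; y] | x in S, y in S & G x y].

(* Only nonempty induced subgraphs are tested, so G[set0] has degeneracy 0.   *)
Definition degenerate S (k : nat) : bool :=
  [forall U : {set V},
    (U \subset S) && (U != set0) ==> [exists v in U, degree U v <= k]%N].

Lemma degenerate_ex S : exists k, degenerate S k.
Proof.
exists #|V|; apply/forallP => U; apply/implyP => /andP[_ /set0Pn[v vU]].
by apply/existsP; exists v; rewrite vU max_card.
Qed.

Definition degeneracy S : nat := ex_minn (degenerate_ex S).

End Graphs.

Definition log2 (R : realType) (x : R) : R := ln x / ln 2.

Section RandomColoring.
Variables (R : realType) (V : finType) (l : nat).

(* 'I_l plays the role of the color set [l] = {1, ..., l}. *)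
Definition coloring := {ffun V -> 'I_l}.

Definition color_class (psi : coloring) (i : 'I_l) : {set V} :=
  [set v | psi v == i].

(* Product over the vertices of the uniform distribution on 'I_l. *)
Definition Pr (E : pred coloring) : R :=
  \sum_(psi : coloring | E psi) \prod_(v : V) l%:R^-1.

End RandomColoring.

(* An absolute value only to cast from int to nat: all uses have 0 <= x. *)
Definition ceiln (R : realType) (x : R) : nat := `|Num.ceil x|%N.

(* Main.v *)
Require Import Defs.
From HB Require Import structures.
From mathcomp Require Import all_boot all_order all_algebra.
From mathcomp Require Import reals sequences exp.
From mathcomp Require Import ring lra.

Set Implicit Arguments.
Unset Strict Implicit.
Unset Printing Implicit Defensive.

Import Order.TTheory GRing.Theory Num.Theory.

Local Open Scope ring_scope.

(** Peeling off vertices of minimum degree assigns to every vertex v a set N v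
    of at most kappa neighbours such that every nonempty vertex set U has an
    element v all of whose neighbours in U lie in N v.  Hence the degeneracy of
    a color class is at most the largest number of vertices of that color in
    one of the sets N v.  The latter numbers, as well as the sizes of the color
    classes, are sums of independent indicators, so that a Chernoff bound and a
    union bound over the (at most n^2) pairs of a vertex and a color give (i)
    and (ii); when l = 1 both hold trivially.  Finally (iii) follows from (i)
    because a d-degenerate graph on m vertices has at most d * m edges. *)

(** * Degeneracy, backward neighbors and edge counts *)

Section Degeneracy.
Variables (V : finType) (G : sgraph V).
Implicit Types (S A U : {set V}) (N : V -> {set V}).

(** A degeneracy ordering encoded without an order: [N v] is meant as the set of neighbors of [v]
    still present when [v] is peeled off, and the witness in [U] as its first peeled vertex. *)
Definition backward_neighbors S N :=
  forall U, U \subset S -> U != set0 ->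
    exists2 v, v \in U & [set w in U | G v w] \subset N v.

Lemma degenerate_degeneracy S : degenerate G S (degeneracy G S).
Proof. by rewrite /degeneracy; case: ex_minnP. Qed.

Lemma degeneracy_min S k : degenerate G S k -> (degeneracy G S <= k)%N.
Proof. by rewrite /degeneracy; case: ex_minnP => m _ mmin /mmin. Qed.

Lemma degenerate_backward_neighbors S k : degenerate G S k ->
  exists2 N : V -> {set V}, forall v, (#|N v| <= k)%N & backward_neighbors S N.
Proof.
have [m] := ubnP #|S|; elim: m S => // m IHm S; rewrite ltnS => leSm degS.
have [->|S0] := eqVneq S set0.
  exists (fun=> set0) => [v|U]; first by rewrite cards0.
  by rewrite subset0 => /eqP-> /eqP.
have /existsP[v /andP[vS dv]] :=
  implyP (forallP degS S) (introT andP (conj (subxx S) S0)).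
have [||N Nk NP] := IHm (S :\ v).
- by rewrite (leq_trans _ leSm) // [leqRHS](cardsD1 v) vS.
- apply/forallP => U; apply/implyP => /andP[US U0].
  by apply: (implyP (forallP degS U)); rewrite U0 (subset_trans US) ?subsetDl.
(* The peeled vertex [v] receives all its neighbors in [S]. It serves every [U] that contains it,
   and any other [U] lies in [S :\ v]. *)
exists (fun u => if u == v then [set w in S | G v w] else N u) => [u|U US U0].
  by case: eqP.
have [vU|vU] := boolP (v \in U).
  exists v => //; rewrite eqxx; apply/subsetP => w; rewrite !inE.
  by move=> /andP[/(subsetP US)-> ->].
have [|u uU uN] := NP U _ U0; first by rewrite subsetD1 US.
by exists u => //; case: eqP vU uU => // -> /negbTE->.
Qed.

(** If G[A] has degeneracy d + 1, some nonempty [U] inside [A] has all degrees above d, and the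
    vertex [v] supplied for [U] has all its neighbors in [U] within [N v :&: A]. The case of
    degeneracy 0 is settled by [0 <= x]. *)
Lemma degeneracy_le_backward (R : realType) S A N (x : R) : 0 <= x ->
  backward_neighbors S N -> A \subset S ->
  (forall v, #|N v :&: A|%:R <= x) -> (degeneracy G A)%:R <= x.
Proof.
move=> x0 NP AS Nx; case E : (degeneracy G A) => [|d] //.
have /forallPn[U] : ~~ degenerate G A d.
  by apply/negP => /degeneracy_min; rewrite E ltnn.
rewrite negb_imply => /andP[/andP[UA U0] /existsPn degU].
have [v vU vN] := NP U (subset_trans UA AS) U0.
apply: le_trans (Nx v); rewrite ler_nat.
have := degU v; rewrite vU /= -ltnNge => /leq_trans; apply.
apply: subset_leq_card; rewrite subsetI vN /=; apply/subsetP => w.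
by rewrite inE => /andP[wU _]; exact: (subsetP UA).
Qed.

(** Each edge is charged to one endpoint: the backward property of the pair [[set x; y]] puts one
    endpoint into the [N] of the other. *)
Lemma card_edges_le S : (#|edges G S| <= degeneracy G S * #|S|)%N.
Proof.
have [N Nk NP] := degenerate_backward_neighbors (degenerate_degeneracy S).
have edgesN : edges G S \subset \bigcup_(v in S) [set [set v; w] | w in N v].
  apply/subsetP => e /imset2P[x y xS]; rewrite inE => /andP[yS Gxy] {e}->.
  have US : [set x; y] \subset S by rewrite subUset !sub1set xS.
  have [|v] := NP _ US; first by apply/set0Pn; exists x; rewrite set21.
  rewrite !inE => /orP[]/eqP-> /subsetP vN; apply/bigcupP.
  - exists x => //; apply/imsetP; exists y => //; apply: vN.
    by rewrite !inE eqxx orbT.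
  - exists y => //; apply/imsetP; exists x; last by rewrite setUC.
    by apply: vN; rewrite !inE eqxx adj_sym.
apply: (leq_trans (subset_leq_card edgesN)).
apply: (@leq_trans (\sum_(v in S) #|[set [set v; w] | w in N v]|)).
  elim/big_rec2: _ => [|v m A _ IH]; first by rewrite cards0.
  by rewrite (leq_trans (leq_card_setU _ _)) // leq_add2l.
rewrite mulnC -sum_nat_const; apply: leq_sum => v _.
exact: leq_trans (leq_imset_card _ _) (Nk v).
Qed.

End Degeneracy.

Lemma sum_card_color_class (V : finType) (l : nat) (psi : coloring V l) :
  (\sum_(i < l) #|color_class psi i|)%N = #|V|.
Proof.
rewrite -sum1_card (partition_big psi predT) //=.
by apply: eq_bigr => i _; rewrite -sum1_card; apply: eq_bigl => v; rewrite inE.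
Qed.

Lemma card_monochromatic_le (R : realType) (V : finType) (G : sgraph V)
    (l : nat) (psi : coloring V l) (x : R) :
  (forall i, (degeneracy G (color_class psi i))%:R <= x) ->
  #|\bigcup_(i < l) edges G (color_class psi i)|%:R <= x * #|V|%:R.
Proof.
move=> degx; rewrite -(sum_card_color_class psi) natr_sum mulr_sumr.
apply: (@le_trans _ _ (\sum_(i < l) #|edges G (color_class psi i)|%:R)).
  rewrite -natr_sum ler_nat; elim/big_rec2: _ => [|v m A _ IH].
    by rewrite cards0.
  by rewrite (leq_trans (leq_card_setU _ _)) // leq_add2l.
apply: ler_sum => i _.
apply: (@le_trans _ _ (degeneracy G (color_class psi i) *
                       #|color_class psi i|)%N%:R).
  by rewrite ler_nat card_edges_le.
by rewrite natrM ler_wpM2r.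
Qed.

(** * Exponential moments and Chernoff bounds *)

Lemma expR_le_quadratic (R : realType) (t : R) :
  0 <= t <= 2^-1 -> expR t <= 1 + t + t ^+ 2.
Proof.
(* [expR t <= (1 - t / 3) ^- 3], the latter being sharp enough on [0, 1/2] *)
move=> /andP[t0 t1].
have e1 : 1 - t / 3 <= expR (- (t / 3)) by have := expR_ge1Dx (- (t / 3)).
have e3 : (1 - t / 3) ^+ 3 <= expR (- t).
  have -> : - t = - (t / 3) * 3%:R by field.
  by rewrite expRM_natr lerXn2r // nnegrE ?expR_ge0 //; lra.
rewrite -[t in expR t]opprK expRN invf_ple ?posrE ?expR_gt0 //; last nra.
apply: le_trans e3.
rewrite -div1r ler_pdivrMr; last nra.
rewrite -subr_ge0.
(* The affine part drops to -1/54 at t = 1/2; the last term compensates for it. *)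
have -> : (1 - t / 3) ^+ 3 * (1 + t + t ^+ 2) - 1 =
  t ^+ 2 * ((3^-1 - 19 / 27 * t) + t ^+ 2 * (8 - t) / 27) by field.
rewrite mulr_ge0 ?sqr_ge0 //; nra.
Qed.

Section Probability.
Variables (R : realType) (V : finType) (l : nat).
Implicit Types (E F : pred (coloring V l)) (S : {set V}) (i : 'I_l).

Let wt : R := \prod_(v : V) l%:R^-1.

Let wt_ge0 : 0 <= wt.
Proof. by apply: prodr_ge0 => v _; rewrite invr_ge0. Qed.

Lemma Pr_ge0 E : 0 <= Pr R E.
Proof. exact: sumr_ge0. Qed.

Lemma Pr_mono E F : (forall psi, E psi -> F psi) -> Pr R E <= Pr R F.
Proof.
move=> EF; rewrite /Pr [leRHS](bigID E) /=.
rewrite (eq_bigl E) => [|psi]; last first.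
  by apply: andb_idl => /EF.
by rewrite lerDl sumr_ge0.
Qed.

Hypothesis l_gt0 : (0 < l)%N.

Lemma Pr_sure E : (forall psi, E psi) -> Pr R E = 1.
Proof.
move=> Et; rewrite /Pr (@eq_bigl _ _ _ _ _ E predT) //.
rewrite -(bigA_distr_bigA (fun _ _ => l%:R^-1)) /=.
rewrite big1 // => v _; rewrite sumr_const card_ord -[LHS]mulr_natl divff //.
by rewrite pnatr_eq0 -lt0n.
Qed.

Lemma Pr_union_bound (T : finType) (bad : T -> pred (coloring V l)) E :
  (forall psi, ~~ E psi -> exists x, bad x psi) ->
  1 - \sum_x Pr R (bad x) <= Pr R E.
Proof.
move=> badE; rewrite -(@Pr_sure predT) // lerBlDr /Pr [leLHS](bigID E) /=.
rewrite lerD2l.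
have -> : \sum_x \sum_(psi | bad x psi) wt =
    \sum_psi \sum_x if bad x psi then wt else 0.
  by rewrite exchange_big; apply: eq_bigr => x _; rewrite [LHS]big_mkcond.
rewrite [leLHS]big_mkcond.
apply: ler_sum => psi _; have ge0 x : 0 <= if bad x psi then wt else 0.
  by case: ifP.
case: ifP => [/badE[x xb]|_]; last exact: sumr_ge0.
by rewrite (bigD1 x) //= xb lerDl sumr_ge0.
Qed.

(** By independence the moment factors over the vertices; each vertex of [S] contributes 1 + (e^t -
    1) / l, bounded by [1 + x <= expR x], and every other vertex contributes 1. *)
Lemma exp_moment_color S i (t : R) :
  \sum_(psi : coloring V l)
    wt * expR (t * #|S :&: color_class psi i|%:R) <=
  expR (#|S|%:R * ((expR t - 1) / l%:R)).
Proof.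
pose F v (j : 'I_l) : R :=
  l%:R^-1 * (if (v \in S) && (j == i) then expR t else 1).
have l0 : l%:R != 0 :> R by rewrite pnatr_eq0 -lt0n.
rewrite (eq_bigr (fun psi : coloring V l => \prod_v F v (psi v))); last first.
  move=> psi _; rewrite big_split /=; congr (_ * _).
  rewrite -big_mkcond /= (eq_bigl [in S :&: color_class psi i]); last first.
    by move=> v; rewrite !inE.
  by rewrite prodr_const expRM_natr.
rewrite -bigA_distr_bigA /= expRM_natl -prodr_const.
rewrite [leRHS]big_mkcond /=; apply: ler_prod => v _; apply/andP; split.
  apply: sumr_ge0 => j _; rewrite /F mulr_ge0 ?invr_ge0 //.
  by case: ifP => _; rewrite ?expR_ge0.
rewrite -mulr_sumr; case: (v \in S) => /=; last first.
  by rewrite sumr_const card_ord mulVf.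
rewrite (bigD1 i) //= eqxx (eq_bigr (fun=> 1)); last first.
  by move=> j /negbTE->.
rewrite sumr_const cardC1 card_ord -subn1 natrB //.
apply: le_trans (expR_ge1Dx _); rewrite le_eqVlt; apply/orP; left.
by apply/eqP; field.
Qed.

(** Markov's inequality for the exponential moment, with [m / l] as an upper bound for the mean. *)
Lemma chernoff_color S i (m d : R) : #|S|%:R <= m -> 0 <= d <= 1 ->
  Pr R (fun psi : coloring V l =>
      (1 + d) * m / l%:R < #|S :&: color_class psi i|%:R) <=
  expR (- (m / l%:R * d ^+ 2 / 4)).
Proof.
(* The choice t = d/2 minimizes t^2 - t d, giving -d^2/4, and [d <= 1] keeps t within the range
   [0, 1/2] of the quadratic bound. *)
move=> Sm /andP[d0 d1]; set t := d / 2; set mu := m / l%:R.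
have m0 : 0 <= m by apply: le_trans Sm.
have mu0 : 0 <= mu by rewrite divr_ge0.
have t0 : 0 <= t by rewrite /t; lra.
have et : expR t <= 1 + t + t ^+ 2.
  by apply: expR_le_quadratic; rewrite t0 /t; lra.
set a := (1 + d) * m / l%:R.
have -> : - (mu * d ^+ 2 / 4) = mu * (t + t ^+ 2) - t * a.
  by rewrite /a /mu /t; field; rewrite pnatr_eq0 -lt0n.
rewrite expRD expRN ler_pdivlMr ?expR_gt0 //.
apply: (@le_trans _ _ (expR (#|S|%:R * ((expR t - 1) / l%:R)))); last first.
  rewrite ler_expR mulrA mulrAC ler_pM ?divr_ge0 ?ler_wpM2r ?invr_ge0 //.
    by rewrite subr_ge0 -expR0 ler_expR.
  by lra.
apply: le_trans (exp_moment_color S i t).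
rewrite /Pr mulr_suml [leLHS]big_mkcond; apply: ler_sum => psi _.
case: ifP => [aX|_]; last by rewrite mulr_ge0 ?expR_ge0.
by rewrite ler_wpM2l // ler_expR ler_wpM2l // ltW.
Qed.

(* The constant 3 pays for a union bound over at most [#|V| ^ 2] events. *)
Lemma chernoff_family (N : V -> {set V}) (m d : R) :
  (forall v, #|N v|%:R <= m) -> 0 <= d <= 1 -> (l <= #|V|)%N ->
  3 * ln #|V|%:R <= m / l%:R * d ^+ 2 / 4 ->
  1 - 1 / #|V|%:R <= Pr R (fun psi : coloring V l =>
    [forall v, forall i, #|N v :&: color_class psi i|%:R <= (1 + d) * m / l%:R]).
Proof.
move=> Nm d01 lV lnV.
have n0 : 0 < #|V|%:R :> R by rewrite ltr0n (leq_trans l_gt0).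
pose bad (x : V * 'I_l) (psi : coloring V l) :=
  (1 + d) * m / l%:R < #|N x.1 :&: color_class psi x.2|%:R.
apply: le_trans (@Pr_union_bound _ bad _ _); last first.
  move=> psi /forallPn[v] /forallPn[i]; rewrite -ltNge => vi.
  by exists (v, i).
rewrite lerD2l lerN2.
apply: (@le_trans _ _ (\sum_(x : V * 'I_l) #|V|%:R ^- 3)).
  apply: ler_sum => -[v i] _; apply: le_trans (chernoff_color i (Nm v) d01) _.
  rewrite -[in leRHS](lnK n0) -expRM_natr -expRN ler_expR lerN2.
  by rewrite mulrC.
rewrite sumr_const card_prod card_ord -[leLHS]mulr_natl natrM.
rewrite ler_pdivrMr ?exprn_gt0 //.
have -> : 1 / #|V|%:R * #|V|%:R ^+ 3 = #|V|%:R * #|V|%:R :> R.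
  by field; rewrite lt0r_neq0.
by rewrite ler_wpM2l // ler_nat.
Qed.

End Probability.

(** * Logarithm and ceiling estimates *)

Lemma ln2_le (R : realType) : ln 2 <= 3 / 4 :> R.
Proof.
rewrite -ler_expR lnK ?posrE //.
(* The sixth power of 9/8 just exceeds 2. *)
have -> : 3 / 4 = 8^-1 * 6%:R :> R by field.
rewrite expRM_natr.
have e1 : 9 / 8 <= expR 8^-1 :> R.
  by apply: le_trans (expR_ge1Dx _); lra.
apply: (@le_trans _ _ ((9 / 8) ^+ 6)); first by lra.
by apply: lerXn2r; rewrite ?nnegrE ?expR_ge0 //; lra.
Qed.

(** The factor 4/3 is exactly what turns the Chernoff exponent [9 / 4 * L] of (i) into the required
    [3 * ln n]. *)
Lemma ln_le_log2 (R : realType) (x : R) : 1 <= x -> 4 / 3 * ln x <= log2 x.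
Proof.
move=> x1; have l2 := ln2_le R; have lx := ln_ge0 x1.
have l20 : 0 < ln 2 :> R by rewrite ln_gt0 // ltr1n.
rewrite /log2 ler_pdivlMr //; nra.
Qed.

Lemma ceiln_ge (R : realType) (x : R) : 0 <= x -> x <= (ceiln x)%:R.
Proof.
move=> x0; rewrite /ceiln natr_absz ger0_norm ?ceil_ge //.
by rewrite ceil_ge0 (lt_le_trans _ x0) // ltrN10.
Qed.

Lemma ceiln_lt (R : realType) (x : R) : 0 <= x -> (ceiln x)%:R < x + 1.
Proof.
move=> x0; rewrite /ceiln natr_absz ger0_norm.
  by have := gt_pred_ceil x; rewrite intrB ltrBlDr; apply; exact: num_real.
by rewrite ceil_ge0 (lt_le_trans _ x0) // ltrN10.
Qed.

(** * The three bounds for a random coloring *)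

Theorem theorem3p1 (R : realType) :
  exists2 C : R, 0 < C & exists2 c : nat, (0 < c)%N &
  forall (V : finType) (G : sgraph V) (k s : R),
    let n : R := #|V|%:R in
    let kappa : R := (degeneracy G [set: V])%:R in
    1 <= k <= n ->
    C * n * log2 n <= s ->
    let l : nat := ceiln (2 * n * k / s) in
    let lambda : R := 3 * Num.sqrt (kappa * l%:R * log2 n) in
    [/\ k <= 2 * kappa ->
          1 - 1 / n ^+ c <= Pr R (fun psi : coloring V l =>
            [forall i : 'I_l,
              (degeneracy G (color_class psi i))%:R <= (kappa + lambda) / l%:R]),
        1 - 1 / n ^+ c <= Pr R (fun psi : coloring V l =>
          [forall i : 'I_l, #|color_class psi i|%:R <= 2 * n / l%:R])
      & kappa <= k <= 2 * kappa ->
          1 - 1 / n ^+ c <= Pr R (fun psi : coloring V l =>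
            #|\bigcup_(i < l) edges G (color_class psi i)|%:R <= s)].
Proof.
(* 72 = 4 * 2 * 9, with 4 from [l * s <= 4 * n * k], 2 from [k <= 2 * kappa] and 9 from the square
   of the constant in [lambda]; this yields [lambda <= kappa] once [l > 1]. *)
exists 72; first by [].
exists 1%N; first by [].
move=> V G k s n kappa /andP[k1 kn] hs l lambda; rewrite expr1.
have n1 : 1 <= n := le_trans k1 kn.
(* For n = 1 the claimed lower bounds are 0; otherwise [log2 n >= 1], which makes [s] positive. *)
have := n1; rewrite le_eqVlt => /orP[/eqP n_eq1|n_gt1].
  by rewrite -n_eq1 divr1 subrr; split=> *; exact: Pr_ge0.
have n0 : 0 < n by lra.
have n2 : 2 <= n by move: n_gt1; rewrite ltr1n ler_nat.
have L1 : 1 <= log2 n.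
  rewrite ler_pdivlMr ?mul1r; last by rewrite ln_gt0 // ltr1n.
  by rewrite ler_ln ?posrE.
have L0 : 0 < log2 n by rewrite (lt_le_trans ltr01).
have lnL := ln_le_log2 n1.
have lnn0 := ln_ge0 n1.
set L := log2 n in hs lambda L1 L0 lnL *.
have nL0 : 0 < n * L by rewrite mulr_gt0.
have s0 : 0 < s by apply: lt_le_trans hs; rewrite -mulrA; lra.
have x0 : 0 < 2 * n * k / s by rewrite divr_gt0 // mulr_gt0 //; lra.
have xl : 2 * n * k / s <= l%:R by rewrite ceiln_ge // ltW.
have lx : l%:R < 2 * n * k / s + 1 by rewrite ceiln_lt // ltW.
have l_gt0 : (0 < l)%N by rewrite -(ltr0n R); lra.
have l0 : 0 < l%:R :> R by rewrite ltr0n.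
have nk_le : 2 * n * k <= l%:R * s by rewrite -ler_pdivrMr.
(* For [l >= 2], rounding up at most doubles [2 * n * k / s]. *)
have lk : (1 < l)%N -> 18 * (l%:R * L) <= k.
  move=> l1; have {}l1 : 2 <= l%:R :> R by rewrite ler_nat.
  have : l%:R * s <= 4 * n * k.
    by rewrite -ler_pdivlMr //; lra.
  have := ler_wpM2l (ltW l0) hs; rewrite -(ler_pM2r n0); nra.
have lV : (l <= #|V|)%N.
  have [l1|l1] := ltnP 1 l; last first.
    by rewrite (leq_trans l1) // -(ler_nat R).
  rewrite -(ler_nat R) -/n; have := lk l1; nra.
have lambda0 : 0 <= lambda by rewrite mulr_ge0 ?sqrtr_ge0.
have kappa0 : 0 <= kappa by rewrite ler0n.
have lambda2 : lambda ^+ 2 = 9 * kappa * l%:R * L.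
  rewrite exprMn sqr_sqrtr; first by lra.
  by apply: mulr_ge0; [exact: mulr_ge0|exact: ltW].
(* This is (i), stated apart because (iii) reuses it. *)
have degeneracy_classes : k <= 2 * kappa -> 1 - 1 / n <= Pr R (fun psi : coloring V l =>
    [forall i, (degeneracy G (color_class psi i))%:R <= (kappa + lambda) / l%:R]).
  move=> k_le; have kappa_gt0 : 0 < kappa by lra.
  have [N Nk NP] :=
    degenerate_backward_neighbors (degenerate_degeneracy G [set: V]).
  have th0 : 0 <= (kappa + lambda) / l%:R by rewrite divr_ge0 // addr_ge0.
  have [l1|l1] := ltnP 1 l; last first.
    rewrite Pr_sure ?gerBl ?divr_ge0 // => psi; apply/forallP => i.
    apply: (degeneracy_le_backward th0 NP (subsetT _)) => v.
    have -> : l%:R = 1 :> R by apply/eqP; rewrite pnatr_eq1 eqn_leq l1.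
    rewrite divr1 (@le_trans _ _ kappa) ?lerDl // ler_nat.
    exact: leq_trans (subset_leq_card (subsetIl _ _)) (Nk v).
  have := lk l1 => {}lk.
  (* With d = [lambda / kappa] and m = [kappa] the Chernoff threshold is [(kappa + lambda) / l]. *)
  have d01 : 0 <= lambda / kappa <= 1.
    rewrite divr_ge0 //= ler_pdivrMr // mul1r.
    rewrite -(@ler_pXn2r _ 2) ?nnegrE // lambda2; nra.
  apply: le_trans (chernoff_family l_gt0 (m := kappa) _ d01 lV _) _.
  - by move=> v; rewrite ler_nat.
  - rewrite -/n expr_div_n lambda2.
    have -> : kappa / l%:R * (9 * kappa * l%:R * L / kappa ^+ 2) / 4 = 9 / 4 * L.
      by field; rewrite !lt0r_neq0.
    lra.
  apply: Pr_mono => psi /forallP NA; apply/forallP => i.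
  apply: (degeneracy_le_backward th0 NP (subsetT _)) => v.
  have /forallP/(_ i) := NA v; congr (_ <= _); field.
  by rewrite !lt0r_neq0.
split=> //.
- have [l1|l1] := ltnP 1 l; last first.
    rewrite Pr_sure ?gerBl ?divr_ge0 // ?ltW // => psi; apply/forallP => i.
    have -> : l%:R = 1 :> R by apply/eqP; rewrite pnatr_eq1 eqn_leq l1.
    rewrite divr1 (@le_trans _ _ n) ?ler_nat ?max_card //; lra.
  have d01 : 0 <= (1 : R) <= 1 by rewrite ler01 lexx.
  (* Taking every [N v] to be the whole vertex set and d = 1 gives the threshold [2 * n / l]; the
     exponent [n / (4 * l)] is large because [18 * (l * L) <= k <= n]. *)
  apply: le_trans (chernoff_family l_gt0 (N := fun=> setT) (m := n) _ d01 lV _) _.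
  - by move=> v; rewrite cardsT.
  - rewrite -/n expr1n mulr1 !ler_pdivlMr //.
    by have := ler_wpM2l (ltW l0) lnL; have := lk l1; nra.
  apply: Pr_mono => psi /forallP NA; apply/forallP => i.
  have /card_gt0P[v _] : (0 < #|V|)%N by rewrite (leq_trans l_gt0).
  by have /forallP/(_ i) := NA v; rewrite setTI.
- move=> /andP[kappa_k k_le]; apply: le_trans (degeneracy_classes k_le) _.
  apply: Pr_mono => psi /forallP/card_monochromatic_le/le_trans; apply.
  rewrite -/n mulrAC ler_pdivrMr //.
  (* l s - kappa n >= l s / 2 dominates lambda n *)
  have : lambda * n <= l%:R * s / 2.
    have ls0 : 0 <= l%:R * s / 2 by rewrite divr_ge0 // mulr_ge0 // ltW.
    have ln0 : 0 <= lambda * n := mulr_ge0 lambda0 (ltW n0).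
    rewrite -(@ler_pXn2r _ 2) ?nnegrE // exprMn lambda2.
    (* The first factor is bounded through [kappa <= k] and [2 * n * k <= l * s], the second through
       the sparsity hypothesis on [s]. *)
    have /(ler_wpM2l (ltW l0)) : kappa * n * (72 * n * L) <= l%:R * s / 2 * s.
      by apply: ler_pM => //; nra.
    have -> : 9 * kappa * l%:R * L * n ^+ 2 =
      l%:R * (kappa * n * (72 * n * L)) / 8 by field.
    by have := sqr_ge0 (l%:R * s); lra.
  nra.
Qed.
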